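(* Let $(M,d)$ be a compact pointed metric space. Any one of the following conditions implies that $M$ is Lip-lin injective. (a) The one-dimensional Hausdorff measure of $M$ is $0$. (b) There exists $\rho>1$ such that for every $\varepsilon>0$, $M$ can be covered by finitely many balls $B(x_i,r)$ of (common) radius $r\le\varepsilon$ such that the balls $B(x_i,\rho r)$ are pairwise disjoint. (b') There exists $\rho>0$ such that for every $\varepsilon>0$, $M$ can be covered by finitely many closed sets $E_i$ such that $\sup_i \operatorname{diam}(E_i)=r\le\varepsilon$ and the sets $[E_i]_{\rho r}:=\{x\in M: d(x,E_i)\le \rho r\}$ are pairwise disjoint. (c) For every $x\in M$, $\lambda(\{d(x,y):y\in M\})=0$. (c') There exists $C>0$ such that for every $x\ne y\in M$ there exists $\varphi\in \mathrm{Lip}_0(M)$ with $\|\varphi\|_L\le C$, $\varphi(x)-\varphi(y)\ge d(x,y)$ and $\lambda(\varphi(M))=0$.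
   Context: A pointed metric space is a metric space with a distinguished base point $0$. $\mathrm{Lip}_0(M,N)$ is the set of Lipschitz maps $f\colon M\to N$ with $f(0)=0$; $\mathrm{Lip}_0(M)=\mathrm{Lip}_0(M,\mathbb R)$ is a Banach space for the norm $\|f\|_L$ = best Lipschitz constant of $f$. For $x\in M$, $\delta(x)\in \mathrm{Lip}_0(M)^*$ is the evaluation $\langle f,\delta(x)\rangle=f(x)$. The Lipschitz-free space $\mathcal F(M)$ is the norm-closed linear span of $\{\delta(x):x\in M\}$ in $\mathrm{Lip}_0(M)^*$. For $f\in \mathrm{Lip}_0(M,N)$, $\widehat f\colon \mathcal F(M)\to\mathcal F(N)$ is the unique bounded linear operator with $\widehat f(\delta(x))=\delta(f(x))$ for all $x\in M$. A complete pointed metric space $M$ is Lip-lin injective if for every complete pointed metric space $N$ and every injective $f\in \mathrm{Lip}_0(M,N)$, the operator $\widehat f$ is injective. $B(p,r)$ is the closed ball of radius $r>0$ around $p$, and $\lambda$ is Lebesgue measure on $\mathbb R$. *)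

(* Defs.v *)
From HB Require Import structures.
From mathcomp Require Import all_boot all_order all_algebra.
From mathcomp Require Import all_classical all_reals all_analysis.

Set Implicit Arguments.
Unset Strict Implicit.
Unset Printing Implicit Defensive.

Import Order.TTheory GRing.Theory Num.Theory.
Import numFieldNormedType.Exports.

Local Open Scope classical_set_scope.
Local Open Scope ring_scope.

#[short(type="pointedMetricType")]
HB.structure Definition PointedMetric (R : numDomainType) :=
  {M of Metric R M & isPointed M}.

HB.instance Definition _ (R : numFieldType) := Metric.on R^o.

(* The property required by the library's [completeType]. *)
Definition complete_space (T : puniformType) : Prop :=
  forall F : set_system T, ProperFilter F -> cauchy F -> cvg F.

Lemma le_scal_closed (R : realType) (a c d : R) : 0 <= d ->
  (forall e, 0 < e -> a <= (c + e) * d) -> a <= c * d.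
Proof.
rewrite le_eqVlt => /predU1P[<- /(_ 1 ltr01)|d0 h]; first by rewrite !mulr0.
apply/ler_addgt0Pr => e e0; have := h (e / d) (divr_gt0 e0 d0).
by rewrite mulrDl divfK ?gt_eqF.
Qed.

(* Used for the two norms below: P v c reads "c is a Lipschitz constant of v",
   respectively "v is a functional bounded by c"; the infimum is attained. *)
Definition best_constant (R : realType) (V : Type) (P : V -> R -> Prop)
    (v : V) : R :=
  inf [set c | 0 <= c /\ P v c].

Section best_constant.
Context (R : realType) (V : lmodType R) (P : V -> R -> Prop).
Local Notation best_constant := (best_constant P).

Hypothesis Pex : forall v, exists c, 0 <= c /\ P v c.
Hypothesis Pclosed : forall v c,
  (forall e, 0 < e -> P v (c + e)) -> P v c.
Hypothesis Pmono : forall v c d, c <= d -> P v c -> P v d.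
Hypothesis PD : forall v w c d, P v c -> P w d -> P (v + w) (c + d).
Hypothesis PZ : forall a v c, P v c -> P (a *: v) (`|a| * c).
Hypothesis P0 : forall v, P v 0 -> v = 0.

Let Plb v : has_lbound [set c | 0 <= c /\ P v c].
Proof. by exists 0 => c []. Qed.

Let Pinf v : has_inf [set c | 0 <= c /\ P v c].
Proof. by split => //; have [c ?] := Pex v; exists c. Qed.

Lemma best_constant_ge0 v : 0 <= best_constant v.
Proof. by apply: lb_le_inf => [|c []//]; have [c ?] := Pex v; exists c. Qed.

Lemma best_constantP v : P v (best_constant v).
Proof.
apply: Pclosed => e e0.
have [c [_ Pc] /ltW cl] := inf_adherent e0 (Pinf v).
exact: Pmono Pc.
Qed.

Lemma best_constant_le v c : 0 <= c -> P v c -> best_constant v <= c.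
Proof. by move=> c0 Pc; apply: ge_inf. Qed.

Lemma best_constantD v w :
  best_constant (v + w) <= best_constant v + best_constant w.
Proof.
apply: best_constant_le; first by rewrite addr_ge0 ?best_constant_ge0.
by apply: PD; exact: best_constantP.
Qed.

Let best_constantZ_le a v : best_constant (a *: v) <= `|a| * best_constant v.
Proof.
apply: best_constant_le; first by rewrite mulr_ge0 ?best_constant_ge0.
by apply: PZ; exact: best_constantP.
Qed.

Lemma best_constant_eq0 v : best_constant v = 0 -> v = 0.
Proof. by move=> v0; apply: P0; rewrite -v0; exact: best_constantP. Qed.

Lemma best_constantZ a v : best_constant (a *: v) = `|a| * best_constant v.
Proof.
apply/eqP; rewrite eq_le best_constantZ_le /=.
have [->|a0] := eqVneq a 0.
  by rewrite normr0 mul0r; exact: best_constant_ge0.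
rewrite -ler_pdivlMl ?normr_gt0// -normfV.
by have := best_constantZ_le a^-1 (a *: v); rewrite scalerA mulVf// scale1r.
Qed.

End best_constant.

Section lip0.
Context (R : realType).

Definition klipschitz (M N : pointedMetricType R) (k : R) (f : M -> N) :=
  forall x y, mdist (f x) (f y) <= k * mdist x y.

Definition lip0_pred (M N : pointedMetricType R) : {pred M -> N} :=
  mem [set f | (exists k : R, klipschitz k f) /\ f point = point].

Record lip0 (M N : pointedMetricType R) := Lip0 {
  lip0_fun :> M -> N ;
  lip0_subproof : lip0_fun \in @lip0_pred M N }.

HB.instance Definition _ M N := [isSub for @lip0_fun M N].
HB.instance Definition _ M N := [Choice of lip0 M N by <:].

End lip0.

(* Lip_0(M) = Lip_0(M, R); R^o is R with its usual metric, based at 0. *)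
Definition lip0R (R : realType) (M : pointedMetricType R) := lip0 M R^o.

Section lip0_real.
Context (R : realType) (M : pointedMetricType R).

HB.instance Definition _ := SubChoice.on (lip0R M).

Lemma lip0_submod_closed : submod_closed (@lip0_pred R M R^o).
Proof.
split; first by rewrite inE; split => //; exists 0 => x y;
  rewrite /mdist/= subrr normr0 mul0r.
move=> a f g; rewrite !inE => -[[k kf] f0] [[l lg] g0]; split; last first.
  by rewrite /= !fctE f0 g0 /point /= scaler0 addr0.
exists (`|a| * k + l) => x y; rewrite /mdist/= opprD addrACA -scalerBr.
rewrite mulrDl (le_trans (ler_normD _ _))// lerD//.
  by rewrite normrM -mulrA ler_wpM2l//; exact: kf.
exact: lg.
Qed.

HB.instance Definition _ := GRing.isSubmodClosed.Build R (M -> R^o)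
  (@lip0_pred R M R^o) lip0_submod_closed.
HB.instance Definition _ := [SubChoice_isSubLmodule of lip0R M by <:].

Lemma lip0_0 (f : lip0R M) : f point = 0.
Proof. by have := lip0_subproof f; rewrite inE => -[]. Qed.

Lemma lip0D (f g : lip0R M) x : (f + g) x = f x + g x.
Proof. by []. Qed.

Lemma lip0Z a (f : lip0R M) x : (a *: f) x = a *: f x.
Proof. by []. Qed.

Let ex (f : lip0R M) : exists c, 0 <= c /\ klipschitz c f.
Proof.
have := lip0_subproof f; rewrite inE => -[[k kf] _].
exists `|k|; split => // x y; apply: le_trans (kf x y) _.
by rewrite ler_wpM2r ?mdist_ge0 ?ler_norm.
Qed.

Let closed (f : lip0R M) c :
  (forall e, 0 < e -> klipschitz (c + e) f) -> klipschitz c f.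
Proof.
move=> h x y; apply: le_scal_closed => [|e /h]; [exact: mdist_ge0|exact].
Qed.

Let mono (f : lip0R M) c d : c <= d -> klipschitz c f -> klipschitz d f.
Proof.
by move=> cd h x y; apply: le_trans (h x y) _; rewrite ler_wpM2r ?mdist_ge0.
Qed.

Let add (f g : lip0R M) c d :
  klipschitz c f -> klipschitz d g -> klipschitz (c + d) (f + g : lip0R M).
Proof.
move=> cf dg x y; rewrite /mdist/= opprD addrACA mulrDl.
by rewrite (le_trans (ler_normD _ _))// lerD//; [exact: cf|exact: dg].
Qed.

Let scale a (f : lip0R M) c :
  klipschitz c f -> klipschitz (`|a| * c) (a *: f : lip0R M).
Proof.
move=> cf x y; rewrite /mdist/= -scalerBr normrM -mulrA ler_wpM2l//.
exact: cf.
Qed.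

Let zero (f : lip0R M) : klipschitz 0 f -> f = 0.
Proof.
move=> h; apply: val_inj; apply/funext => x /=.
have := h x point; rewrite mul0r /mdist/= lip0_0 sub0r normrN.
by rewrite normr_le0 => /eqP.
Qed.

HB.instance Definition _ := Lmodule_isNormed.Build R (lip0R M)
  (best_constantD ex closed mono add) (best_constantZ ex closed mono scale)
  (best_constant_eq0 ex closed mono zero).

Lemma lip0_normE (f : lip0R M) :
  `|f| = best_constant (fun (g : lip0R M) k => klipschitz k g) f.
Proof. by []. Qed.

Lemma lip0_normP (f : lip0R M) x y : `|f x - f y| <= `|f| * mdist x y.
Proof. by rewrite distrC; exact: (best_constantP ex closed mono). Qed.

Lemma lip0_norm_le (f : lip0R M) c : 0 <= c ->
  (forall x y, `|f x - f y| <= c * mdist x y) -> `|f| <= c.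
Proof.
move=> c0 h; apply: best_constant_le => // x y.
by rewrite /mdist/= distrC; exact: h.
Qed.

End lip0_real.

Section dual.
Context (R : realType) (V : normedModType R).

Definition dual_pred : {pred V -> R^o} :=
  mem [set phi : V -> R^o |
    linear phi /\ exists k : R, forall v, `|phi v| <= k * `|v|].

Record dual := Dual {
  dual_fun :> V -> R^o ;
  dual_subproof : dual_fun \in dual_pred }.

HB.instance Definition _ := [isSub for dual_fun].
HB.instance Definition _ := [Choice of dual by <:].

Lemma dual_submod_closed : submod_closed dual_pred.
Proof.
split.
  rewrite inE; split; first by move=> a u v; rewrite scaler0 addr0.
  by exists 0 => v; rewrite normr0 mul0r.
move=> a f g; rewrite !inE => -[lf [k kf]] [lg [l lgl]]; split.
  move=> b u v; rewrite !fctE lf lg !scalerDr !scalerA (mulrC a b).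
  by rewrite addrACA.
exists (`|a| * k + l) => v; rewrite !fctE mulrDl.
rewrite (le_trans (ler_normD _ _))// lerD// normrM -mulrA ler_wpM2l//.
Qed.

HB.instance Definition _ := GRing.isSubmodClosed.Build R (V -> R^o)
  dual_pred dual_submod_closed.
HB.instance Definition _ := [SubChoice_isSubLmodule of dual by <:].

Lemma dual_linear (phi : dual) : linear phi.
Proof. by have := dual_subproof phi; rewrite inE => -[]. Qed.

Lemma dualDE (phi psi : dual) v : (phi + psi) v = phi v + psi v.
Proof. by []. Qed.

Lemma dualZE a (phi : dual) v : (a *: phi) v = a *: phi v.
Proof. by []. Qed.

Definition dual_bound (phi : dual) (k : R) := forall v, `|phi v| <= k * `|v|.

Let ex (f : dual) : exists c, 0 <= c /\ dual_bound f c.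
Proof.
have := dual_subproof f; rewrite inE => -[_ [k kf]].
exists `|k|; split => // v; apply: le_trans (kf v) _.
by rewrite ler_wpM2r ?ler_norm.
Qed.

Let closed (f : dual) c :
  (forall e, 0 < e -> dual_bound f (c + e)) -> dual_bound f c.
Proof. by move=> h v; apply: le_scal_closed => [//|e /h]; exact. Qed.

Let mono (f : dual) c d : c <= d -> dual_bound f c -> dual_bound f d.
Proof.
by move=> cd h v; apply: le_trans (h v) _; rewrite ler_wpM2r.
Qed.

Let add (f g : dual) c d :
  dual_bound f c -> dual_bound g d -> dual_bound (f + g) (c + d).
Proof.
move=> cf dg v; rewrite dualDE mulrDl.
by rewrite (le_trans (ler_normD _ _))// lerD//.
Qed.

Let scale a (f : dual) c : dual_bound f c -> dual_bound (a *: f) (`|a| * c).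
Proof. by move=> cf v; rewrite dualZE normrM -mulrA ler_wpM2l//; exact: cf. Qed.

Let zero (f : dual) : dual_bound f 0 -> f = 0.
Proof.
move=> h; apply: val_inj; apply/funext => v /=.
by have := h v; rewrite mul0r normr_le0 => /eqP.
Qed.

HB.instance Definition _ := Lmodule_isNormed.Build R dual
  (best_constantD ex closed mono add) (best_constantZ ex closed mono scale)
  (best_constant_eq0 ex closed mono zero).

Lemma dual_normE (phi : dual) : `|phi| = best_constant dual_bound phi.
Proof. by []. Qed.

Lemma dual_normP (phi : dual) v : `|phi v| <= `|phi| * `|v|.
Proof. exact: (best_constantP ex closed mono). Qed.

Lemma dual_norm_le (phi : dual) c : 0 <= c ->
  (forall v, `|phi v| <= c * `|v|) -> `|phi| <= c.
Proof. by move=> c0 h; apply: best_constant_le. Qed.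

End dual.

Definition lin_span (R : realType) (V : lmodType R) (A : set V) : set V :=
  [set v | exists n (a : 'I_n -> R) (u : 'I_n -> V),
     (forall i, A (u i)) /\ v = \sum_(i < n) a i *: u i].

Section closed_span.
Context (R : realType) (V : normedModType R).
Implicit Types (A : set V) (v : V).

Lemma lin_span_linear A a u v :
  lin_span A u -> lin_span A v -> lin_span A (a *: u + v).
Proof.
move=> [n [b [s [As ->]]]] [m [c [t [At ->]]]].
exists (n + m)%N.
exists (fun i => match fintype.split i with inl j => a * b j | inr j => c j end).
exists (fun i => match fintype.split i with inl j => s j | inr j => t j end).
split; first by move=> i; case: (fintype.split i).
rewrite big_split_ord scaler_sumr; congr (_ + _); apply: eq_bigr => i _.
  by rewrite (unsplitK (inl i)) scalerA.
by rewrite (unsplitK (inr i)).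
Qed.

Lemma closure_normP A v :
  closure A v <-> forall e, 0 < e -> exists u, A u /\ `|v - u| < e.
Proof.
split=> [h e e0|h B /nbhs_ballP[e /= e0 eB]].
  have [u [Au]] := h _ (nbhsx_ballx v e e0).
  by rewrite -ball_normE => uv; exists u.
have [u [Au uv]] := h _ e0; exists u; split=> //; apply: eB.
by rewrite -ball_normE.
Qed.

Lemma closed_span_submod A : submod_closed (mem (closure (lin_span A))).
Proof.
split.
  rewrite inE; apply: subset_closure; exists 0%N, (fun=> 0), (fun=> 0).
  by split => [[]//|]; rewrite big_ord0.
move=> a u v; rewrite !inE => /closure_normP uA /closure_normP vA.
apply/closure_normP => e e0.
have a0 : 0 < `|a| + 1 by rewrite ltr_wpDl.
have [|u' [Au' uu']] := uA (e / 2 / (`|a| + 1)); first by rewrite !divr_gt0.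
have [|v' [Av' vv']] := vA (e / 2); first by rewrite divr_gt0.
exists (a *: u' + v'); split; first exact: lin_span_linear.
rewrite opprD addrACA -scalerBr (le_lt_trans (ler_normD _ _))//.
rewrite (splitr e) ler_ltD// normrZ.
rewrite (le_trans (ler_wpM2l _ (ltW uu')))// mulrCA ler_piMr//.
  by rewrite ltW// divr_gt0.
by rewrite ler_pdivrMr// mul1r lerDl.
Qed.

End closed_span.

Section free_space.
Context (R : realType) (M : pointedMetricType R).

Lemma delta_subproof (x : M) :
  (fun f : lip0R M => f x : R^o) \in @dual_pred R (lip0R M).
Proof.
rewrite inE; split=> //; exists (mdist x point) => f.
by rewrite mulrC -[f x]subr0 -[X in _ - X](lip0_0 f); exact: lip0_normP.
Qed.

Definition delta (x : M) : dual (lip0R M) := Dual (delta_subproof x).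

Definition free_pred : {pred dual (lip0R M)} :=
  mem (closure (lin_span (range delta))).

Record free_space := Free {
  free_val :> dual (lip0R M) ;
  free_subproof : free_val \in free_pred }.

HB.instance Definition _ := [isSub for free_val].
HB.instance Definition _ := [Choice of free_space by <:].
HB.instance Definition _ := GRing.isSubmodClosed.Build R (dual (lip0R M))
  free_pred (closed_span_submod _).
HB.instance Definition _ := [SubChoice_isSubLmodule of free_space by <:].

Let normD (m n : free_space) :
  `|free_val (m + n)| <= `|free_val m| + `|free_val n|.
Proof. exact: ler_normD. Qed.

Let normZ a (m : free_space) : `|free_val (a *: m)| = `|a| * `|free_val m|.
Proof. exact: normrZ. Qed.

Let norm0 (m : free_space) : `|free_val m| = 0 -> m = 0.
Proof. by move=> /normr0_eq0 m0; exact: val_inj. Qed.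

HB.instance Definition _ :=
  Lmodule_isNormed.Build R free_space normD normZ norm0.

Lemma free_normE (m : free_space) : `|m| = `|free_val m|.
Proof. by []. Qed.

Lemma free_delta_subproof x : delta x \in free_pred.
Proof.
rewrite inE; apply: subset_closure; exists 1%N, (fun=> 1), (fun=> delta x).
by split=> [_|]; [exists x|rewrite big_ord1 scale1r].
Qed.

Definition free_delta (x : M) : free_space := Free (free_delta_subproof x).

End free_space.

Section linearization.
Context (R : realType) (M N : pointedMetricType R).

Definition bounded_operator (V W : normedModType R) (T : V -> W) :=
  exists k : R, forall v, `|T v| <= k * `|v|.

Definition is_linearization (f : lip0 M N)
    (T : {linear free_space M -> free_space N}) :=
  bounded_operator T /\ forall x, T (free_delta x) = free_delta (f x).

Lemma is_linearization_uniq (f : lip0 M N) S T :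
  is_linearization f S -> is_linearization f T -> S =1 T.
Proof.
move=> [[k kS] Sd] [[l lT] Td] m; apply/eqP; rewrite -subr_eq0 -normr_le0.
apply/ler_addgt0Pr => e e0; rewrite add0r.
have c0 : 0 < `|k| + `|l| + 1 by rewrite ltr_wpDl ?addr_ge0.
have : closure (lin_span (range (@delta R M))) (free_val m).
  by have := free_subproof m; rewrite inE.
move=> /closure_normP/(_ _ (divr_gt0 e0 c0))[u [[n [a [s [sd ->]]]]]].
have /choice[x xd] : forall i, exists x, delta x = s i.
  by move=> i; have [x _ <-] := sd i; exists x.
pose w : free_space M := \sum_(i < n) a i *: free_delta (x i).
have <- : \val w = \sum_(i < n) a i *: s i.
  by rewrite /w raddf_sum; apply: eq_bigr => i _; rewrite -xd.
rewrite -[_ - _]/(free_val (m - w)) -free_normE => mw.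
have -> : S m - T m = S (m - w) - T (m - w).
  suff Sw : S w = T w.
    by rewrite [S (m - w)]linearB [T (m - w)]linearB Sw opprB addrA subrK.
  rewrite !linear_sum; apply: eq_bigr => i _.
  by rewrite !linearZ/= Sd Td.
rewrite (le_trans (ler_normB _ _))//.
apply: (@le_trans _ _ ((`|k| + `|l| + 1) * `|m - w|)); last first.
  by rewrite mulrC -ler_pdivlMr// ltW.
rewrite !mulrDl ler_wpDr ?mul1r// lerD//.
  by rewrite (le_trans (kS _))// ler_wpM2r// ler_norm.
by rewrite (le_trans (lT _))// ler_wpM2r// ler_norm.
Qed.

Section adjoint.
Variable f : lip0 M N.

Let fL : exists k, 0 <= k /\ klipschitz k f.
Proof.
have := lip0_subproof f; rewrite inE => -[[k kf] _].
exists `|k|; split => // x y; apply: le_trans (kf x y) _.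
by rewrite ler_wpM2r ?mdist_ge0 ?ler_norm.
Qed.

Let f0 : f point = point.
Proof. by have := lip0_subproof f; rewrite inE => -[]. Qed.

Let comp_bound (g : lip0R N) k : 0 <= k -> klipschitz k f ->
  forall x y, `|g (f x) - g (f y)| <= k * `|g| * mdist x y.
Proof.
move=> k0 kf x y; rewrite (le_trans (lip0_normP _ _ _))//.
by rewrite (mulrC k) -mulrA ler_wpM2l.
Qed.

Let comp_subproof (g : lip0R N) :
  (fun x => g (f x)) \in @lip0_pred R M R^o.
Proof.
rewrite inE; split; last by rewrite f0 lip0_0.
have [k [k0 kf]] := fL; exists (k * `|g|) => x y.
by rewrite /mdist/= distrC; exact: comp_bound.
Qed.

Let comp (g : lip0R N) : lip0R M := Lip0 (comp_subproof g).

Let compP a g h : comp (a *: g + h) = a *: comp g + comp h.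
Proof. exact: val_inj. Qed.

Let comp_le k g : 0 <= k -> klipschitz k f -> `|comp g| <= k * `|g|.
Proof.
move=> k0 kf; apply: lip0_norm_le; first by rewrite mulr_ge0.
exact: comp_bound.
Qed.

Let adj_subproof (phi : dual (lip0R M)) :
  (fun g => phi (comp g)) \in @dual_pred R (lip0R N).
Proof.
rewrite inE; split=> [a u v|]; first by rewrite compP dual_linear.
have [k [k0 kf]] := fL; exists (`|phi| * k) => g.
by rewrite (le_trans (dual_normP phi (comp g)))// -mulrA ler_wpM2l// comp_le.
Qed.

Let adj (phi : dual (lip0R M)) : dual (lip0R N) := Dual (adj_subproof phi).

Let adjP a phi psi : adj (a *: phi + psi) = a *: adj phi + adj psi.
Proof. exact: val_inj. Qed.

Let adj_le : exists k, 0 <= k /\ forall phi, `|adj phi| <= k * `|phi|.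
Proof.
have [k [k0 kf]] := fL; exists k; split=> // phi.
apply: dual_norm_le => [|g]; first by rewrite mulr_ge0.
rewrite (le_trans (dual_normP phi (comp g)))// (mulrC k) -mulrA ler_wpM2l//.
exact: comp_le.
Qed.

Let adj_span phi : lin_span (range (@delta R M)) phi ->
  lin_span (range (@delta R N)) (adj phi).
Proof.
move=> [n [a [s [sd ->]]]]; exists n, a, (adj \o s); split=> [i|].
  by have [x _ /= <-] := sd i; exists (f x) => //; exact: val_inj.
have adj0 : adj 0 = 0 by exact: val_inj.
apply: (big_ind2 (fun u v => adj u = v)) => // [u ? v ? <- <-|i _].
  by rewrite -[u in LHS]scale1r adjP scale1r.
by rewrite -[_ *: _ in LHS]addr0 adjP adj0 addr0.
Qed.

Let free_adj_subproof (m : free_space M) : adj m \in @free_pred R N.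
Proof.
have := free_subproof m; rewrite !inE => /closure_normP h.
apply/closure_normP => e e0; have [k [k0 kadj]] := adj_le.
have k1 : 0 < k + 1 by rewrite ltr_wpDl.
have [u [Au mu]] := h _ (divr_gt0 e0 k1).
exists (adj u); split; first exact: adj_span.
have -> : adj m - adj u = adj (free_val m - u) by exact: val_inj.
apply: (le_lt_trans (kadj _)); move: mu; rewrite ltr_pdivlMr// => mu.
by apply: le_lt_trans mu; rewrite mulrC ler_wpM2l// lerDl.
Qed.

Let free_adj (m : free_space M) : free_space N := Free (free_adj_subproof m).

Let free_adj_linear : linear free_adj.
Proof. by move=> a u v; do 2 apply: val_inj. Qed.

HB.instance Definition _ := GRing.isLinear.Build R (free_space M) (free_space N)
  *:%R free_adj free_adj_linear.

Lemma is_linearization_ex : exists T, is_linearization f T.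
Proof.
exists free_adj; split=> [|x]; last by do 2 apply: val_inj.
by have [k [_ kadj]] := adj_le; exists k => m; exact: kadj.
Qed.

End adjoint.

(* The unique such operator, by [is_linearization_uniq]. *)
Definition linearization (f : lip0 M N) :
    {linear free_space M -> free_space N} :=
  projT1 (cid (is_linearization_ex f)).

Lemma linearizationP (f : lip0 M N) : is_linearization f (linearization f).
Proof. exact: (projT2 (cid (is_linearization_ex f))). Qed.

End linearization.

Definition lip_lin_injective (R : realType) (M : pointedMetricType R) : Prop :=
  complete_space M /\
  forall N : pointedMetricType R, complete_space N ->
  forall f : lip0 M N, injective f -> injective (linearization f).

Section metric_notions.
Context (R : realType) (M : pointedMetricType R).
Implicit Types A E : set M.

(* The library's [closed_ball] is the closure of the open ball, which is
   smaller in general. *)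
Definition cball (p : M) (r : R) : set M := [set x | mdist p x <= r].

(* Adjoining 0 only matters for the empty set, whose diameter is 0. *)
Definition diam A : \bar R :=
  ereal_sup (0%E |` [set (mdist z.1 z.2)%:E | z in A `*` A]).

(* Equal to +oo when E is empty. *)
Definition dist_to (x : M) E : \bar R :=
  ereal_inf [set (mdist x y)%:E | y in E].

Definition nbhd E (r : R) : set M := [set x | (dist_to x E <= r%:E)%E].

Definition hausdorff1_pre (d : R) A : \bar R :=
  ereal_inf [set (\sum_(0 <= i <oo) diam (U i))%E | U in
    [set U : (set M)^nat |
      A `<=` \bigcup_i U i /\ forall i, (diam (U i) <= d%:E)%E]].

Definition hausdorff1 A : \bar R :=
  ereal_sup [set hausdorff1_pre d A | d in [set d | 0 < d]].

End metric_notions.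

(* Main.v *)
(* If f is injective on the compact space M and G is locally constant, then G
   factors through f as a Lipschitz function of f: d(f x, f y) is bounded below
   on the compact set {G x <> G y}. Extended by McShane, it shows that m(G) = 0
   for each m in the kernel of the linearization of f. Since m is continuous
   for bounded pointwise convergence, m = 0 as soon as each Lipschitz function
   is a uniform limit of locally constant functions with bounded Lipschitz
   constants. Under (b) and (b') these are the functions constant on the pieces
   of the cover. Under (c'), choose an open U of small measure e containing
   phi(M): h(t) = t - lambda(U `&` ]-oo, t]) is 1-Lipschitz, moves differences
   by at most e and is locally constant on U, so that h \o phi is a locally
   constant function that almost separates x and y as phi does; finite maxima
   and minima of such functions then approximate any Lipschitz function, as in
   the Stone-Weierstrass theorem. (c) is (c') for phi = d(x, .), and (a)
   implies (c). *)
Require Import Defs.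
From HB Require Import structures.
From mathcomp Require Import all_boot all_order all_algebra.
From mathcomp Require Import all_classical all_reals all_analysis.
From mathcomp Require Import measurable_realfun lra.

Set Implicit Arguments.
Unset Strict Implicit.
Unset Printing Implicit Defensive.

Import Order.TTheory GRing.Theory Num.Theory.
Import numFieldNormedType.Exports.

Local Open Scope classical_set_scope.
Local Open Scope ring_scope.

(** * Lipschitz and locally constant functions, and factoring them through an injective map *)

Section lipschitz.
Context (R : realType).
Implicit Types M N : pointedMetricType R.

Definition locally_constant M (G : M -> R) :=
  forall x, \forall y \near x, G y = G x.

Definition rlipschitz M (C : R) (G : M -> R) :=
  forall x y, `|G x - G y| <= C * mdist x y.

(** [C] may depend on [F] but not on [e]: passing to the limit in the free space requires a common
    Lipschitz bound. *)
Definition locally_constant_dense M :=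
  forall F : lip0R M, exists C, forall e, 0 < e -> exists G : M -> R,
    [/\ locally_constant G, rlipschitz C G & forall x, `|G x - F x| <= e].

Lemma near_mdist M (x : M) (e : R) : 0 < e -> \forall y \near x, mdist x y < e.
Proof.
by move=> e0; apply/metricType_numDomainType.nbhs_mdistP; exists e.
Qed.

Lemma rlipschitz_near M (C : R) (G : M -> R) x (e : R) : rlipschitz C G ->
  0 < e -> \forall y \near x, `|G x - G y| < e.
Proof.
move=> CG e0; have C1 : 0 < `|C| + 1 by rewrite ltr_wpDl.
apply: filterS (near_mdist x (divr_gt0 e0 C1)) => y.
rewrite ltr_pdivlMr// => xy; apply: le_lt_trans (CG x y) _.
apply: le_lt_trans xy; rewrite mulrC ler_wpM2l ?mdist_ge0//.
by rewrite (le_trans (ler_norm _))// lerDl.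
Qed.

Lemma lip0_klipschitz M N (f : lip0 M N) : exists2 k, 0 <= k & klipschitz k f.
Proof.
have := lip0_subproof f; rewrite inE => -[[k kf] _].
exists `|k| => // x y; apply: le_trans (kf x y) _.
by rewrite ler_wpM2r ?mdist_ge0 ?ler_norm.
Qed.

Lemma lip0_point M N (f : lip0 M N) : f point = point.
Proof. by have := lip0_subproof f; rewrite inE => -[]. Qed.

Lemma lip0_near M N (f : lip0 M N) x (e : R) : 0 < e ->
  \forall y \near x, mdist (f x) (f y) < e.
Proof.
move=> e0; have [k k0 kf] := lip0_klipschitz f.
have k1 : 0 < k + 1 by rewrite ltr_wpDl.
apply: filterS (near_mdist x (divr_gt0 e0 k1)) => y.
rewrite ltr_pdivlMr// => xy; apply: le_lt_trans (kf x y) _.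
by apply: le_lt_trans xy; rewrite mulrC ler_wpM2l ?mdist_ge0// lerDl.
Qed.

Lemma rlipschitz_lip0 M (C : R) (G : M -> R) : rlipschitz C G -> G point = 0 ->
  exists g : lip0R M, g =1 G.
Proof.
move=> CG G0.
have GP : (G : M -> R^o) \in @lip0_pred R M R^o.
  rewrite inE; split=> //; exists C => x y.
  by rewrite /mdist/= distrC; exact: CG.
by exists (Lip0 GP).
Qed.

(** McShane's formula: take the infimum over [x] of [G x + L * mdist (f x) z]. *)
Lemma mcshane M N (f : M -> N) (G : M -> R) (L : R) : 0 <= L ->
  (forall x y, `|G x - G y| <= L * mdist (f x) (f y)) ->
  exists2 g : N -> R, rlipschitz L g & forall x, g (f x) = G x.
Proof.
move=> L0 GL.
pose S z := [set G x + L * mdist (f x) z | x in [set: M]].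
have Slb z c : (forall x, c <= G x + L * mdist (f x) z) -> c <= inf (S z).
  move=> h; apply: lb_le_inf; first by eexists; exists point.
  by move=> _ [x _ <-].
have Sinf z x : inf (S z) <= G x + L * mdist (f x) z.
  apply: ge_inf; last by exists x.
  exists (G x - L * mdist (f x) z) => _ [y _ <-].
  have := GL x y; rewrite ler_norml => /andP[_ h].
  have := ler_wpM2l L0 (metric_triangle (f x) z (f y)).
  rewrite mulrDr (metric_sym z); lra.
exists (inf \o S) => [z w|x] /=; last first.
  apply/eqP; rewrite eq_le; apply/andP; split.
    by rewrite (le_trans (Sinf _ x))// mdistxx mulr0 addr0.
  apply: Slb => y; have := GL x y; rewrite ler_norml => /andP[_ h].
  by rewrite (metric_sym (f y)); lra.
wlog suff H : z w / inf (S z) - inf (S w) <= L * mdist z w.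
  rewrite ler_norml H andbT lerNl opprB (metric_sym z); exact: H.
rewrite lerBlDr addrC -lerBlDr; apply: Slb => x; rewrite lerBlDr.
apply: le_trans (Sinf z x) _; rewrite -addrA lerD2l -mulrDr.
by rewrite ler_wpM2l// (le_trans (metric_triangle _ w _))// (metric_sym z).
Qed.

(** Compactness of the square of [M] reduces the bound to a neighbourhood of each pair, for [L]
    large: near the diagonal [G] is constant, and off it injectivity keeps the images apart. *)
Lemma locally_constant_factor M N (f : lip0 M N) (G : M -> R) :
  compact [set: M] -> injective f -> locally_constant G ->
  exists2 L, 0 <= L &
    forall x y, `|G x - G y| <= L * mdist (f x) (f y).
Proof.
move=> Mc fI Gc.
have := compact_setX Mc Mc; rewrite setXTT => /compact_near_coveringP.
move=> /(_ R +oo%R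
  (fun L z => `|G z.1 - G z.2| <= L * mdist (f z.1) (f z.2)) _).
case=> [[x y] _|A [_ AP]]; last first.
  exists (Num.max A 0 + 1).
    by rewrite addr_ge0// le_max lexx orbT.
  move=> x y; apply: (AP _ _ (x, y)) => //.
  by rewrite ltr_pwDr// le_max lexx.
have [exy|nxy] := eqVneq (f x) (f y).
  have {exy} := fI _ _ exy => <-.
  exists ([set u | G u = G x] `*` [set u | G u = G x], [set L | 0 < L]) => /=.
    split; last by exists 0; split => //; rewrite num_real.
    exists ([set u | G u = G x], [set u | G u = G x]) => //.
    by split; exact: Gc.
  move=> [[u v] L] /= [[-> ->] L0].
  by rewrite subrr normr0 mulr_ge0 ?mdist_ge0 ?(ltW L0).
have d0 : 0 < mdist (f x) (f y) by rewrite mdist_gt0.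
set d := mdist (f x) (f y) in d0 *.
(* When both images move by less than [d / 4], they stay at least [d / 2] apart. *)
pose U z := [set u | G u = G z /\ mdist (f z) (f u) < d / 4].
have UN z : nbhs z (U z).
  by apply: filterI; [exact: Gc|apply: lip0_near; rewrite divr_gt0].
exists (U x `*` U y, [set L | `|G x - G y| / (d / 2) < L]) => /=.
  split; last first.
    by exists (`|G x - G y| / (d / 2)); split=> [|//]; rewrite num_real.
  by exists (U x, U y) => //; split; exact: UN.
move=> [[u v] L] /= [[[-> xu] [-> yv]]].
have d2 : 0 < d / 2 by rewrite divr_gt0.
move=> LL; have L0 : 0 <= L.
  by rewrite ltW// (le_lt_trans _ LL)// divr_ge0// ltW.
move: LL; rewrite ltr_pdivrMr// => /ltW/le_trans; apply; rewrite ler_wpM2l//.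
have := metric_triangle (f x) (f u) (f y).
have := metric_triangle (f u) (f v) (f y).
rewrite (metric_sym (f v)) -/d; lra.
Qed.
End lipschitz.

(** * Evaluating free-space elements at Lipschitz functions *)

Section free_space.
Context (R : realType).
Implicit Types M N : pointedMetricType R.

Lemma free_space_dense M (m : free_space M) (e : R) : 0 < e ->
  exists n (a : 'I_n -> R) (x : 'I_n -> M),
    `|m - \sum_i a i *: free_delta (x i)| < e.
Proof.
move=> e0; have := free_subproof m; rewrite inE => /closure_normP/(_ _ e0).
move=> [_ [[n [a [u [ud ->]]]] mu]].
have /choice[x xd] : forall i, exists x, delta x = u i.
  by move=> i; have [x _ <-] := ud i; exists x.
exists n, a, x; set w := \sum_i _; rewrite free_normE.
suff wE : \val w = \sum_(i < n) a i *: u i.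
  by rewrite -[free_val _]/(free_val m - \val w) wE.
by rewrite /w raddf_sum; apply: eq_bigr => i _; rewrite -xd.
Qed.

Lemma free_space_sumE M n (a : 'I_n -> R) (x : 'I_n -> M) (F : lip0R M) :
  free_val (\sum_i a i *: free_delta (x i)) F = \sum_i a i * F (x i).
Proof.
by apply: (big_morph (fun m : free_space M => free_val m F : R)).
Qed.

Lemma free_val_le M (m : free_space M) (F : lip0R M) :
  `|free_val m F| <= `|m| * `|F|.
Proof. exact: dual_normP. Qed.

Lemma free_valB M (m n : free_space M) (F : lip0R M) :
  free_val (m - n) F = free_val m F - free_val n F.
Proof. by []. Qed.

Lemma free_val_subr M (m : free_space M) (F G : lip0R M) :
  free_val m (F - G) = free_val m F - free_val m G.
Proof.
rewrite -[F - G]addrC -[in LHS](scaleN1r G) (dual_linear (free_val m)).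
by rewrite scaleN1r addrC.
Qed.

(** The adjoint formula follows from the values at [free_delta x] on finite combinations, then by
    density, as [linearization f] is bounded. *)
Lemma linearization_eval M N (f : lip0 M N) (m : free_space M)
    (F : lip0R M) (g : lip0R N) : (forall x, g (f x) = F x) ->
  free_val (linearization f m) g = free_val m F.
Proof.
move=> gF; have [[k kb] fd] := linearizationP f.
set T := linearization f in kb fd *.
apply/eqP; rewrite -subr_eq0 -normr_le0; apply/ler_addgt0Pr => e e0.
have c0 : 0 < `|k| * `|g| + `|F| + 1 by rewrite ltr_wpDl ?addr_ge0 ?mulr_ge0.
have [n [a [x]]] := free_space_dense m (divr_gt0 e0 c0).
set w := \sum_i _ => mw.
have Tw : free_val (T w) g = free_val w F.
  rewrite free_space_sumE /w linear_sum.
  under eq_bigr do rewrite linearZ/= fd.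
  by rewrite free_space_sumE; apply: eq_bigr => i _; rewrite gF.
have -> : free_val (T m) g - free_val m F =
    free_val (T (m - w)) g - free_val (m - w) F.
  by rewrite [T (m - w)]linearB !free_valB Tw opprB addrA subrK.
rewrite add0r (le_trans (ler_normB _ _))//.
apply: (@le_trans _ _ ((`|k| * `|g| + `|F| + 1) * `|m - w|)); last first.
  by rewrite mulrC -ler_pdivlMr// ltW.
rewrite !mulrDl ler_wpDr ?mul1r// lerD//; last first.
  by rewrite mulrC; exact: free_val_le.
rewrite (le_trans (free_val_le _ _))// mulrAC ler_wpM2r//.
by rewrite (le_trans (kb _))// ler_wpM2r// ler_norm.
Qed.

(* On bounded subsets of Lip_0(M), elements of the free space are continuous
   for pointwise, a fortiori uniform, convergence. *)
Lemma free_val_limit M (m : free_space M) (F : lip0R M) (C : R) :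
  (forall e, 0 < e -> exists G : lip0R M,
    [/\ `|G| <= C, forall x, `|G x - F x| <= e & free_val m G = 0]) ->
  free_val m F = 0.
Proof.
move=> h; apply/eqP; rewrite -normr_le0; apply/ler_addgt0Pr => e e0.
have C0 : 0 <= C by have [G [GC _ _]] := h 1 ltr01; exact: le_trans GC.
have c0 : 0 < `|F| + C + 1 by rewrite ltr_wpDl ?addr_ge0.
have e2 : 0 < e / 2 by rewrite divr_gt0.
have [n [a [x]]] := free_space_dense m (divr_gt0 e2 c0).
set w := \sum_i _ => mw.
pose A := \sum_i `|a i|.
have A0 : 0 < A + 1 by rewrite ltr_wpDl// sumr_ge0.
(* This uniform error changes the value at [w] by at most [e / 2]; on [m - w] the norm bounds give
   the other half. *)
have [G [GC GF mG]] := h _ (divr_gt0 e2 A0).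
rewrite -[X in `|X|]subr0 -[X in _ - X]mG -free_val_subr.
rewrite -(subrK (free_val w (F - G)) (free_val m _)) -free_valB.
rewrite add0r (le_trans (ler_normD _ _))// (splitr e) lerD//.
  rewrite (le_trans (free_val_le _ _))//.
  apply: (@le_trans _ _ (`|m - w| * (`|F| + C + 1))).
    rewrite ler_wpM2l// (le_trans (ler_normB _ _))// -addrA lerD2l.
    by rewrite (le_trans GC)// lerDl.
  by rewrite -ler_pdivlMr// ltW.
rewrite free_space_sumE (le_trans (ler_norm_sum _ _ _))//.
apply: (@le_trans _ _ (A * (e / 2 / (A + 1)))).
  rewrite mulr_suml ler_sum// => i _; rewrite normrM ler_wpM2l//.
  by rewrite distrC; exact: GF.
rewrite mulrCA ler_piMr ?(ltW e2)//.
by rewrite ler_pdivrMr// mul1r lerDl.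
Qed.

Lemma lip_lin_injective_of_dense M : compact [set: M] ->
  locally_constant_dense M -> lip_lin_injective M.
Proof.
move=> Mc approx; split=> [F PF cF|N _ f fI m n mn].
  by apply: (compact_cauchy_cvg (U := setT)) => //; exact: filterT.
apply/eqP; rewrite -subr_eq0; apply/eqP.
set d := m - n; have d0 : linearization f d = 0.
  by rewrite linearB mn subrr.
suff dF F : free_val d F = 0.
  by do 2 apply: val_inj; apply/funext => F; exact: dF.
have [C CF] := approx F; apply: (@free_val_limit _ _ _ `|C|) => e e0.
have e2 : 0 < e / 2 by rewrite divr_gt0.
have [G [Gc GC GF]] := CF _ e2.
(* The shift makes the function vanish at the base point; since [F] does too, it costs only another
   [e / 2]. *)
pose H x := G x - G point.
have HE x y : H x - H y = G x - G y by rewrite /H opprB addrA subrK.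
have HC : rlipschitz `|C| H.
  move=> x y; rewrite HE (le_trans (GC x y))// ler_wpM2r ?mdist_ge0//.
  exact: ler_norm.
have [L L0 GL] := locally_constant_factor Mc fI Gc.
have [|g gL gf] := @mcshane _ _ _ f H L L0; first by move=> x y; rewrite HE.
have [|g' g'E] := rlipschitz_lip0 gL.
  by rewrite -(lip0_point f) gf /H subrr.
have [|H' H'E] := rlipschitz_lip0 HC; first by rewrite /H subrr.
exists H'; split.
- by apply: lip0_norm_le => // x y; rewrite !H'E.
- move=> x; rewrite H'E /H (splitr e) -addrAC (le_trans (ler_normB _ _))//.
  by rewrite lerD//; have := GF point; rewrite lip0_0 subr0.
- rewrite -(linearization_eval (f := f) _ (g := g')) ?d0// => x.
  by rewrite g'E gf.
Qed.
End free_space.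

(** * Covers by small, well separated closed sets *)

Section partition.
Context (R : realType) (M : pointedMetricType R).

(** Replace [F] by its value at a representative of the piece. For [x], [y] in different pieces the
    representatives are at most [2 * r] farther apart than [x] and [y], and [r < mdist x y / s];
    hence the factor [1 + 2 / s]. *)
Lemma locally_constant_dense_of_partition (s : R) : 0 < s ->
  (forall e : R, 0 < e -> exists (r : R) (n : nat) (E : 'I_n -> set M),
    [/\ r <= e, forall i, closed (E i), \bigcup_i E i = [set: M],
        forall i x y, E i x -> E i y -> mdist x y <= r &
        forall i j x y, i != j -> E i x -> E j y -> s * r < mdist x y]) ->
  locally_constant_dense M.
Proof.
move=> s0 part F; exists (`|F| * (1 + 2 / s)) => e e0.
have F1 : 0 < `|F| + 1 by rewrite ltr_wpDl.
have [r [n [E [re Ec Ecov Er Es]]]] := part _ (divr_gt0 e0 F1).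
have /choice[idx Ei] x : exists i, E i x.
  by have : [set: M] x by []; rewrite -Ecov => -[i _ Eix]; exists i.
pose c x := xget x (E (idx x)).
pose rep i := xget point (E i).
have repE x : E (idx x) (rep (idx x)) by apply: (xgetPex point); exists x.
have r0 : 0 <= r.
  by apply: le_trans (Er _ _ _ (Ei point) (Ei point)); rewrite mdist_ge0.
exists (fun x => F (rep (idx x))); split.
(* The other pieces are finitely many, closed, and miss [x] by separation. *)
- move=> x; have : \forall y \near x, forall j, j != idx x -> ~ E j y.
    apply: filter_forall => j; have [->|jx] := eqVneq j (idx x).
      by apply: nearW => y /eqP.
    apply: filterS (_ : nbhs x (~` E j)) => [y + _//|].
    apply: open_nbhs_nbhs; split; first by rewrite openC.
    move=> /(Es _ _ _ _ jx)/(_ (Ei x)); rewrite mdistxx.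
    by apply/negP; rewrite -leNgt mulr_ge0// ltW.
  apply: filterS => y Ey; congr (F (rep _)); apply/eqP/negPn/negP => /Ey.
  by apply; exact: Ei.
- move=> x y; have [->|xy] := eqVneq (idx x) (idx y).
    by rewrite subrr normr0 !mulr_ge0 ?mdist_ge0// addr_ge0// divr_ge0// ltW.
  rewrite (le_trans (lip0_normP _ _ _))// -mulrA ler_wpM2l//.
  have := Es _ _ _ _ xy (Ei x) (Ei y); rewrite mulrC -ltr_pdivlMr// => rs.
  have := metric_triangle (rep (idx x)) x (rep (idx y)).
  have := metric_triangle x y (rep (idx y)).
  have := Er _ _ _ (repE x) (Ei x); have := Er _ _ _ (Ei y) (repE y).
  rewrite mulrDl mul1r mulrAC -mulrA; lra.
- move=> x; rewrite (le_trans (lip0_normP _ _ _))//.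
  apply: (@le_trans _ _ ((`|F| + 1) * r)); last first.
    by rewrite mulrC -ler_pdivlMr.
  by rewrite ler_pM ?mdist_ge0// ?lerDl//; exact: Er (repE x) (Ei x).
Qed.

End partition.

(** * Collapsing a null subset of the line *)

Section collapse.
Context (R : realType).
Let mu : measure _ _ := @lebesgue_measure R.
Local Open Scope ereal_scope.

Lemma collapse_null (K : set R) (e : R) :
  measurable K -> mu K = 0 -> (0 < e)%R ->
  exists h : R -> R,
    [/\ forall s t, (s <= t -> 0 <= h t - h s <= t - s)%R,
        forall s t, (s <= t -> t - s - e <= h t - h s)%R &
        forall t, K t -> \forall s \near t, h s = h t].
Proof.
move=> mK K0 e0.
have [|U [oU KU]] := lebesgue_regularity_outer mK _ e0; first by rewrite K0.
move=> UKe.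
have mU : measurable U by exact: open_measurable.
have Ue : mu U < e%:E.
  apply: le_lt_trans UKe.
  have := measureU2 mu mK (measurableD mU mK).
  by rewrite setDUK// [X in _ <= X + _]K0 add0e.
have mUI (i : interval R) : measurable (U `&` [set` i]) by exact: measurableI.
have UI (i : interval R) : mu (U `&` [set` i]) < e%:E.
  apply: le_lt_trans Ue; apply: (le_measure mu (mem_set (mUI i)) (mem_set mU)).
  exact: subIsetl.
have Ufin (i : interval R) : mu (U `&` [set` i]) \is a fin_num.
  by rewrite ge0_fin_numE// (lt_trans (UI i))// ltry.
(* From the length of an interval, [h] removes the measure of its part in [U]: less than [e] in any
   case, and everything if the interval lies in [U]. *)
pose h t := (t - fine (mu (U `&` `]-oo, t])))%R.
have hB (s t : R) : (s <= t)%R ->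
    (h t - h s = (t - s) - fine (mu (U `&` `]s, t])))%R.
  move=> st; rewrite /h.
  suff -> : mu (U `&` `]-oo, t]) = mu (U `&` `]-oo, s]) + mu (U `&` `]s, t]).
    by rewrite fineD//; lra.
  rewrite (@itv_bndbnd_setU _ _ _ (BRight s)) ?bnd_simp// setIUr.
  apply: (measureU mu (mUI _) (mUI _)); apply/seteqP; split=> // x [[_ /=]].
  rewrite !in_itv/= => xs [_].
  by move=> /andP[/lt_le_trans/(_ xs)]; rewrite ltxx.
have mst (s t : R) : (s <= t)%R -> mu `]s, t]%classic = (t - s)%:E.
  move=> st; apply: etrans (lebesgue_measure_itv _) _; move: st.
  rewrite /= lte_fin le_eqVlt => /predU1P[->|->//].
  by rewrite ltxx subrr.
exists h; split.
- move=> s t st; rewrite hB// gerBl fine_ge0// andbT subr_ge0.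
  rewrite -lee_fin fineK// -mst//.
  apply: (le_measure mu (mem_set (mUI _)) (mem_set _)); last exact: subIsetr.
  exact: measurable_itv.
- move=> s t st; rewrite hB// lerD2l lerN2 -lee_fin fineK// ltW//.
- move=> t /KU Ut; have : nbhs t U by exact: open_nbhs_nbhs.
  move=> /nbhs_ballP[d /= d0 dU]; apply/nbhs_ballP; exists d => //= s ds.
  have hE (u v : R) : (u <= v)%R -> `]u, v]%classic `<=` U -> h u = h v.
    move=> uv /setIidPr uvU; apply/esym/eqP.
    by rewrite -subr_eq0 hB// uvU mst//= subrr.
  have [st|/ltW ts] := leP s t.
    apply: hE => // u /=; rewrite in_itv/= => /andP[su ut]; apply: dU.
    by move: ds; rewrite /ball/= !ltr_norml; lra.
  apply/esym; apply: hE => // u /=; rewrite in_itv/= => /andP[tu us]; apply: dU.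
  by move: ds; rewrite /ball/= !ltr_norml; lra.
Qed.
End collapse.

(** * Approximation by maxima and minima of separating functions *)

Section separation.
Context (R : realType) (M : pointedMetricType R).
Implicit Types (C e : R).

Lemma finite_net (e : R) : compact [set: M] -> 0 < e ->
  exists s : seq M, forall y, exists2 x, x \in s & mdist x y < e.
Proof.
rewrite compact_cover => Mc e0.
have [x _|y _|D _ Dcov] := Mc M setT (fun x => interior (ball x e)).
- exact: open_interior.
- by exists y => //; exact: nbhsx_ballx.
exists (finmap.enum_fset D) => y; have [x /= xD /interior_subset] := Dcov y I.
by rewrite ballEmdist; exists x.
Qed.

Lemma locally_constant2 (op : R -> R -> R) (G H : M -> R) :
  locally_constant G -> locally_constant H ->
  locally_constant (fun x => op (G x) (H x)).
Proof. by move=> Gc Hc x; apply: filterS2 (Gc x) (Hc x) => y -> ->. Qed.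

Lemma rlipschitz_max C (G H : M -> R) : rlipschitz C G -> rlipschitz C H ->
  rlipschitz C (fun x => Num.max (G x) (H x)).
Proof.
move=> GC HC x y; have := GC x y; have := HC x y; rewrite !ler_norml.
by case: (leP (G x)); case: (leP (G y)); lra.
Qed.

Lemma rlipschitz_min C (G H : M -> R) : rlipschitz C G -> rlipschitz C H ->
  rlipschitz C (fun x => Num.min (G x) (H x)).
Proof.
move=> GC HC x y; have := GC x y; have := HC x y; rewrite !ler_norml.
by case: (leP (G x)); case: (leP (G y)); lra.
Qed.

Context (Mcompact : compact [set: M]) (C : R) (C0 : 0 <= C).
Context (separated : forall (x y : M) e, 0 < e -> exists g : M -> R,
  [/\ locally_constant g, rlipschitz C g & mdist x y - e <= g y - g x]).

(** Take the maximum of 0 and of the functions [g - g x] that separate [x] from the points of a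
    finite net. *)
Lemma locally_constant_approx_mdist (x : M) e : 0 < e -> exists D : M -> R,
  [/\ locally_constant D, rlipschitz C D, D x = 0 &
      forall y, mdist x y - e <= D y].
Proof.
move=> e0; have e2 : 0 < e / 2 by rewrite divr_gt0.
have C1 : 0 < C + 1 by rewrite ltr_wpDl.
(* Between [y] and a net point, [D] and [mdist x] vary together by at most [C + 1] times the
   distance, hence this radius. *)
have [s sP] := finite_net Mcompact (divr_gt0 e2 C1).
have [D [Dc DC Dx Ds]] : exists D : M -> R,
  [/\ locally_constant D, rlipschitz C D, D x = 0 &
      forall y, y \in s -> mdist x y - e / 2 <= D y].
  elim: s {sP} => [|z s [D [Dc DC Dx Ds]]].
    exists (fun=> 0); split=> // [y|y z]; first exact: nearW.
    by rewrite subrr normr0 mulr_ge0// mdist_ge0.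
  have [g [gc gC gxz]] := separated x z e2.
  exists (fun y => Num.max (D y) (g y - g x)); split.
  - exact: (@locally_constant2 (fun a b => Num.max a (b - g x))).
  - by apply: rlipschitz_max => // u v; rewrite opprB addrA subrK; exact: gC.
  - by rewrite Dx subrr maxxx.
  - by move=> y; rewrite inE le_max => /predU1P[->|/Ds ->//]; rewrite gxz orbT.
exists D; split=> // y; have [z zs zy] := sP y.
have := Ds _ zs; have := DC z y; rewrite ler_norml => /andP[_].
move: zy; rewrite ltr_pdivlMr//.
have := metric_triangle x z y; rewrite mulrDr mulr1 mulrC; lra.
Qed.

(** The cone [F x] plus the norm of [F] times [D], with [D] from the previous lemma, lies above
    [F - e] and equals [F] at [x]. The minimum of the cones over a fine net is at most [F] on the
    net, hence at most [F + e] everywhere. *)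
Lemma locally_constant_dense_of_separated : locally_constant_dense M.
Proof.
move=> F; exists (`|F| * C) => e e0.
have F1 : 0 < `|F| + 1 by rewrite ltr_wpDl.
have C1 : 0 < C + 1 by rewrite ltr_wpDl.
have e1 : 0 < e / (`|F| + 1) by rewrite divr_gt0.
have Fe : `|F| * (e / (`|F| + 1)) <= e.
  by rewrite mulrCA ler_piMr ?(ltW e0)// ler_pdivrMr// mul1r lerDl.
set e' := e / (`|F| + 1) in e1 Fe.
have cone x : exists G : M -> R,
    [/\ locally_constant G, rlipschitz (`|F| * C) G, G x = F x &
        forall y, F y - e <= G y].
  have [D [Dc DC Dx De]] := locally_constant_approx_mdist x e1.
  exists (fun y => F x + `|F| * D y); split.
  - by move=> z; apply: filterS (Dc z) => y ->.
  - move=> u v; rewrite opprD addrACA subrr add0r -mulrBr normrM normr_id.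
    by rewrite -mulrA ler_wpM2l.
  - by rewrite Dx mulr0 addr0.
  - move=> y; have := lip0_normP F x y; rewrite ler_norml => /andP[+ _].
    have := ler_wpM2l (normr_ge0 F) (De y); rewrite mulrBr; lra.
have [s sP] := finite_net Mcompact (divr_gt0 e1 C1).
have [G [Gc GC Ge Gs]] : exists G : M -> R,
  [/\ locally_constant G, rlipschitz (`|F| * C) G, forall y, F y - e <= G y &
      forall x, x \in s -> G x <= F x].
  elim: s {sP} => [|z s [G [Gc GC Ge Gs]]].
    by have [G [? ? ? ?]] := cone point; exists G.
  have [H [Hc HC Hz He]] := cone z.
  exists (fun y => Num.min (G y) (H y)); split.
  - exact: locally_constant2.
  - exact: rlipschitz_min.
  - by move=> y; rewrite le_min Ge He.
  - move=> y; rewrite inE ge_min => /predU1P[->|/Gs ->//].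
    by rewrite Hz lexx orbT.
exists G; split=> // y; have [x xs xy] := sP y.
have := Gs _ xs; have := GC x y; have := lip0_normP F x y; have := Ge y.
rewrite !ler_norml.
have : `|F| * ((C + 1) * mdist x y) <= e.
  apply: le_trans Fe; rewrite ler_wpM2l// ltW//.
  by move: xy; rewrite ltr_pdivlMr// mulrC.
rewrite mulrDl mul1r mulrDr !mulrA; lra.
Qed.

End separation.

(** * Lipschitz functions with null image *)

Section null_images.
Context (R : realType) (M : pointedMetricType R).
Context (Mcompact : compact [set: M]).

Lemma rlipschitz_continuous C (G : M -> R) : rlipschitz C G -> continuous G.
Proof.
by move=> GC x; apply/cvgrPdist_lt => e e0; exact: rlipschitz_near GC e0.
Qed.

Lemma measurable_range_rlipschitz C (G : M -> R) :
  rlipschitz C G -> measurable (range G).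
Proof.
move=> GC; apply: compact_measurable; apply: continuous_compact => //.
by apply: continuous_subspaceT; exact: rlipschitz_continuous GC.
Qed.

Lemma mdist_rlipschitz (x : M) : rlipschitz 1 (mdist x).
Proof.
move=> y z; rewrite mul1r ler_norml.
have := metric_triangle x y z; have := metric_triangle x z y.
rewrite (metric_sym z y); lra.
Qed.

(** Compose [G] with the map [h] collapsing its image: [h] is nondecreasing and 1-Lipschitz, so [C]
    is kept, and the increment from [x] to [y] drops by at most [e]. *)
Lemma separated_of_null C (G : M -> R) (x y : M) e : 0 <= C ->
  rlipschitz C G -> lebesgue_measure (range G) = 0%E ->
  mdist x y <= G y - G x -> 0 < e -> exists g : M -> R,
  [/\ locally_constant g, rlipschitz C g & mdist x y - e <= g y - g x].
Proof.
move=> C0 GC G0 Gxy e0.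
have [h [hL he hc]] := collapse_null (measurable_range_rlipschitz GC) G0 e0.
exists (h \o G); split=> [z|u v|]/=.
- have /nbhs_ballP[d /= d0 dh] : \forall s \near G z, h s = h (G z).
    by apply: hc; exists z.
  by apply: filterS (rlipschitz_near z GC d0) => t; exact: dh.
- apply: le_trans (GC u v); have [uv|/ltW vu] := leP (G u) (G v).
    rewrite distrC [leRHS]distrC !ger0_norm ?subr_ge0//.
      by have /andP[] := hL _ _ uv.
    by have /andP[] := hL _ _ uv; rewrite subr_ge0.
  rewrite !ger0_norm ?subr_ge0//; first by have /andP[] := hL _ _ vu.
  by have /andP[] := hL _ _ vu; rewrite subr_ge0.
- have xy : G x <= G y by have := mdist_ge0 x y; lra.
  by have := he _ _ xy; lra.
Qed.

Lemma separated_trivial C (x : M) e : 0 <= C -> 0 < e -> exists g : M -> R,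
  [/\ locally_constant g, rlipschitz C g & mdist x x - e <= g x - g x].
Proof.
move=> C0 e0; exists (fun=> 0); split=> [y|u v|]; first exact: nearW.
  by rewrite subrr normr0 mulr_ge0// mdist_ge0.
by rewrite mdistxx subrr sub0r oppr_le0 ltW.
Qed.

Lemma diam_ge0 (A : set M) : (0 <= diam A)%E.
Proof. by apply: ereal_sup_ubound; left. Qed.

Lemma mdist_le_diam (A : set M) x y :
  A x -> A y -> ((mdist x y)%:E <= diam A)%E.
Proof. by move=> Ax Ay; apply: ereal_sup_ubound; right; exists (x, y). Qed.

(* The image of a set of diameter [d] lies in an interval of length [2 d]. *)
Lemma hausdorff1_null_image (G : M -> R) : rlipschitz 1 G ->
  hausdorff1 [set: M] = 0%E -> lebesgue_measure (range G) = 0%E.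
Proof.
move=> GL H0; apply/eqP; rewrite eq_le measure_ge0 andbT.
apply/lee_addgt0Pr => e e0; rewrite add0e.
(* Any scale would do: only the sum of the diameters matters, and the bound 1 makes each of them
   finite. *)
have : (@hausdorff1_pre R M 1 setT < (e / 2)%:E)%E.
  apply: (@le_lt_trans _ _ 0%E); last by rewrite lte_fin divr_gt0.
  by rewrite -H0; apply: ereal_sup_ubound; exists 1; first exact: ltr01.
move=> /ereal_inf_lt[_ [U [Ucov Ud] <-] Ue].
have Ufin n : diam (U n) \is a fin_num.
  by rewrite ge0_fin_numE ?diam_ge0// (le_lt_trans (Ud n))// ltry.
(* If [U n] is empty, the default centre [G point] is harmless: the diameter is 0 and [J n] is a
   single point. *)
pose c n := G (xget point (U n)); pose d n := fine (diam (U n)).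
have d0 n : 0 <= d n by rewrite fine_ge0// diam_ge0.
pose J n : set R := `[c n - d n, c n + d n]%classic.
have JE n : lebesgue_measure (J n) = (2%:E * diam (U n))%E.
  rewrite /J lebesgue_measure_itv/= lte_fin -(fineK (Ufin n)) -/(d n) -EFinM.
  by case: ltP => ?; congr (_%:E); have := d0 n; lra.
have GJ : range G `<=` \bigcup_n J n.
  move=> _ [x _ <-]; have [n _ Ux] := Ucov x I; exists n => //.
  have Uc : U n (xget point (U n)) by apply: (xgetPex point); exists x.
  have := mdist_le_diam Uc Ux; rewrite -(fineK (Ufin n)) lee_fin -/(d n) => xd.
  have := GL (xget point (U n)) x; rewrite -/(c n) mul1r ler_norml.
  by rewrite /J/= in_itv/=; lra.
have sumU : (\sum_(0 <= n <oo) (2%:E * diam (U n)) <= e%:E)%E.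
  rewrite nneseriesZl => [|n _]; last exact: diam_ge0.
  rewrite (le_trans (lee_wpmul2l _ (ltW Ue)))// -EFinM lee_fin; lra.
have := measure_sigma_subadditive lebesgue_measure
  (fun n => measurable_itv _) (measurable_range_rlipschitz GL) GJ.
move=> /le_trans; apply; apply: le_trans sumU.
by apply: lee_nneseries => n *; [exact: measure_ge0|rewrite [leLHS]JE].
Qed.

End null_images.

Theorem corollary4p9 (R : realType) (M : pointedMetricType R)
    (Mcompact : compact [set: M]) :
  hausdorff1 [set: M] = 0%E \/
  (exists2 rho : R, 1 < rho &
     forall eps : R, 0 < eps ->
     exists (r : R) (n : nat) (x : 'I_n -> M),
       [/\ 0 < r, r <= eps,
           \bigcup_i cball (x i) r = [set: M] &
           trivIset [set: 'I_n] (fun i => cball (x i) (rho * r))]) \/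
  (exists2 rho : R, 0 < rho &
     forall eps : R, 0 < eps ->
     exists (r : R) (n : nat) (E : 'I_n -> set M),
       [/\ forall i, closed (E i),
           \bigcup_i E i = [set: M],
           ereal_sup [set diam (E i) | i in [set: 'I_n]] = r%:E,
           r <= eps &
           trivIset [set: 'I_n] (fun i => nbhd (E i) (rho * r))]) \/
  (forall x : M, lebesgue_measure [set mdist x y | y in [set: M]] = 0%E) \/
  (exists2 C : R, 0 < C &
     forall x y : M, x <> y ->
     exists phi : lip0R M,
       [/\ `|phi| <= C,
           mdist x y <= phi x - phi y &
           lebesgue_measure (range phi) = 0%E]) ->
  lip_lin_injective M.
Proof.
(* Condition (c), with [mdist x] itself as the function to collapse and constant 1; (a) will reduce
   to it. *)
have null_dist : (forall x : M, lebesgue_measure (range (mdist x)) = 0%E) ->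
    lip_lin_injective M.
  move=> null; apply: lip_lin_injective_of_dense => //.
  apply: (locally_constant_dense_of_separated Mcompact ler01) => x y e.
  apply: separated_of_null (null x) _ => //; first exact: mdist_rlipschitz.
  by rewrite mdistxx subr0.
case=> [H0|[[rho rho1 cov]|[[rho rho0 cov]|[//|[C C0 sep]]]]].
- apply: null_dist => x; apply: hausdorff1_null_image => //.
  exact: mdist_rlipschitz.
(* (b): the balls of radius [r] have diameter at most [2 * r]. Points of different balls are more
   than [(rho - 1) * r] apart, as otherwise the enlarged balls would meet; relative to [2 * r] this
   is the ratio [(rho - 1) / 2]. *)
- apply: lip_lin_injective_of_dense => //.
  apply: (@locally_constant_dense_of_partition _ _ ((rho - 1) / 2)) => [|e e0].
    by rewrite divr_gt0// subr_gt0.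
  have [r [n [x [r0 re xcov triv]]]] := cov _ (divr_gt0 e0 (@ltr0Sn R 1)).
  exists (2 * r), n, (fun i => cball (x i) r); split=> //; first by lra.
  + move=> i; rewrite -[cball _ _]/(mdist (x i) @^-1` [set t | t <= r]).
    apply: closed_comp => [y _|]; last exact: closed_le.
    exact: (rlipschitz_continuous (mdist_rlipschitz (x i))).
  + move=> i y z; rewrite /cball/= => xy xz.
    by have := metric_triangle y (x i) z; rewrite (metric_sym y (x i)); lra.
  + move=> i j y z ij; rewrite /cball/= => xy xz.
    rewrite mulrA divfK ?pnatr_eq0// mulrBl mul1r ltNge; apply/negP => yz.
    move/eqP: ij; apply.
    apply: (triv i j) => //; exists z; split; rewrite /cball/=.
      by have := metric_triangle (x i) y z; lra.
    by apply: le_trans xz _; rewrite ler_peMl// ltW.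
(* (b'): a point of [E j] within [rho * r] of a point of [E i] would lie in both enlarged sets. *)
- apply: lip_lin_injective_of_dense => //.
  apply: (locally_constant_dense_of_partition rho0) => e e0.
  have [r [n [E [Ec Ecov Er re triv]]]] := cov _ e0.
  exists r, n, E; split=> // [i x y Ex Ey|i j x y ij Ex Ey].
    rewrite -lee_fin -Er (le_trans (mdist_le_diam Ex Ey))//.
    by apply: ereal_sup_ubound; exists i.
  have r0 : 0 <= r.
    by rewrite -lee_fin -Er (le_trans (diam_ge0 (E i)))//;
      apply: ereal_sup_ubound; exists i.
  rewrite ltNge; apply/negP => xy; move/eqP: ij; apply.
  have nbhdP k u v : E k u -> mdist v u <= rho * r -> nbhd (E k) (rho * r) v.
    move=> Eu vu; rewrite /nbhd/= (@le_trans _ _ (mdist v u)%:E)//.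
    by apply: ereal_inf_lbound; exists u.
  apply: (triv i j) => //; exists y; split.
    by apply: nbhdP Ex _; rewrite metric_sym.
  by apply: nbhdP Ey _; rewrite mdistxx mulr_ge0// ltW.
- apply: lip_lin_injective_of_dense => //.
  apply: (locally_constant_dense_of_separated Mcompact (ltW C0)) => x y e e0.
  (* (c') covers only distinct points; for equal ones a constant function serves. *)
  have [->|/eqP/nesym yx] := eqVneq x y.
    exact: separated_trivial (ltW C0) e0.
  (* The pair is reversed: (c') bounds [phi x - phi y] from below, whereas separation concerns
     [g y - g x]. *)
  have [phi [phiC pxy phi0]] := sep _ _ yx.
  rewrite metric_sym in pxy.
  apply: (separated_of_null Mcompact (ltW C0) _ phi0 pxy e0) => u v.
  by rewrite (le_trans (lip0_normP _ _ _))// ler_wpM2r ?mdist_ge0.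
Qed.
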